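(* Let $n\ge d\ge 1$ be integers. For $r_1(t)>\dots>r_d(t)>0$ satisfying the ODE system $$\dot r_k(t)=\sum_{j\colon j\ne k}\left(\frac{1}{r_k(t)-r_j(t)}+\frac{1}{r_k(t)+r_j(t)}\right)+\frac{n+1}{r_k(t)},\qquad k=1,\dots,d,$$ the rectangular Fisher information satisfies $$\partial_t I(r(t))=-2\left[\sum_{k=1}^d\frac{n+1}{r_k^2}\,\dot r_k^2+\sum_{1\le i<j\le d}\left(\frac{(\dot r_i-\dot r_j)^2}{(r_i-r_j)^2}+\frac{(\dot r_i+\dot r_j)^2}{(r_i+r_j)^2}\right)\right]\le 0.$$
   Context: $r(t)=(r_1(t),\dots,r_d(t))$, a dot denotes the derivative in $t$, and sums over $j$ with $j\neq k$ range over $\{1,\dots,d\}\setminus\{k\}$. The rectangular Fisher information is $$I(r)=\sum_{k=1}^d\left(\sum_{j\colon j\ne k}\left(\frac{1}{r_k-r_j}+\frac{1}{r_k+r_j}\right)+\frac{n+1}{r_k}\right)^2,\qquad r_1>\dots>r_d>0.$$ *)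

(* Defs.v *)
From HB Require Import structures.
From mathcomp Require Import all_boot all_order all_algebra.
From mathcomp Require Import all_classical all_reals all_analysis.
Import Order.TTheory GRing.Theory Num.Theory.
Import numFieldNormedType.Exports.
Local Open Scope classical_set_scope.
Local Open Scope ring_scope.
Set Implicit Arguments.
Unset Strict Implicit.
Unset Printing Implicit Defensive.

(* The open Weyl chamber x_1 > ... > x_d > 0 (indices shifted to 0, ..., d-1). *)
Definition chamber (R : realType) (d : nat) : set ('I_d -> R) :=
  [set x | (forall i j : 'I_d, (i < j)%N -> x j < x i) /\
           (forall i : 'I_d, 0 < x i)].

(* Both the right-hand side of the ODE and the summand (before squaring) of
   the rectangular Fisher information. *)
Definition drift (R : realType) (n d : nat) (x : 'I_d -> R) (k : 'I_d) : R :=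
  \sum_(j < d | j != k) ((x k - x j)^-1 + (x k + x j)^-1) + (n%:R + 1) / x k.

Definition fisher_info (R : realType) (n d : nat) (x : 'I_d -> R) : R :=
  \sum_(k < d) drift n x k ^+ 2.

(* [dot r k t] is the time derivative of the k-th coordinate of the curve r;
   [derive1] is total, so differentiability is always assumed separately. *)
Definition dot (R : realType) (d : nat) (r : R -> 'I_d -> R) (k : 'I_d) (t : R)
    : R :=
  ((fun s : R => r s k)^`()%classic) t.

Definition solves_on (R : realType) (n d : nat) (J : set R)
    (r : R -> 'I_d -> R) : Prop :=
  forall t : R, J t -> forall k : 'I_d,
    derivable (fun s : R => r s k) t 1 /\ dot r k t = drift n (r t) k.

(* Main.v *)
Require Import Defs.
From HB Require Import structures.
From mathcomp Require Import all_boot all_order all_algebra.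
From mathcomp Require Import all_classical all_reals all_analysis.
From mathcomp Require Import ring.
Import Order.TTheory GRing.Theory Num.Theory.
Import numFieldNormedType.Exports.
Local Open Scope classical_set_scope.
Local Open Scope ring_scope.

(** On the chamber the drift is the gradient of the concave function
    [\sum_(i < j) (ln (x i - x j) + ln (x i + x j)) + (n + 1) \sum_k ln (x k)],
    so the curve is a gradient flow and [fisher_info] is the squared length of
    its velocity [v].  Along a gradient flow of a function [U], the derivative
    of [|v|^2] is twice the Hessian form [Hess U (v, v)], and each logarithm of
    a linear form [l] contributes [- l(v)^2 / l(x)^2] to that form.  The terms
    of [E] are twice these contributions, all nonpositive.

    Concretely, [is_derive_drift] differentiates the drift along a curve, which
    gives the vector [drift_deriv x v] (the Hessian applied to [v]), and
    [drift_deriv_quadratic_form] rewrites its inner product with [v] as a sum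
    over pairs of indices: the summands [(k, j)] and [(j, k)] combine into the
    squares of [v k - v j] and of [v k + v j].  This inner
    product is half the derivative of [fisher_info], since by the differential
    equation the drift on the curve equals [v]. *)

Lemma sum_offdiag_pairs (V : nmodType) (d : nat) (F : 'I_d -> 'I_d -> V) :
  \sum_(k < d) \sum_(j < d | j != k) F k j =
  \sum_(i < d) \sum_(j < d | (i < j)%N) (F i j + F j i).
Proof.
rewrite (eq_bigr (fun k : 'I_d => \sum_(j < d | (k < j)%N) F k j +
                                  \sum_(j < d | (j < k)%N) F k j)); last first.
  move=> k _; rewrite (bigID (fun j : 'I_d => (k < j)%N)) /=.
  by congr (_ + _); apply: eq_bigl => j; rewrite -val_eqE /=;
    case: (ltngtP j k).
rewrite big_split /= [X in _ + X](exchange_big_dep xpredT) //= -big_split /=.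
by apply: eq_bigr => i _; rewrite -big_split.
Qed.

Lemma is_derive1_sum (R : realType) (d : nat) (P : pred 'I_d)
    (h : 'I_d -> R -> R) (dh : 'I_d -> R) (t : R) :
  (forall i, P i -> is_derive t 1 (h i) (dh i)) ->
  is_derive t 1 (fun s => \sum_(i < d | P i) h i s) (\sum_(i < d | P i) dh i).
Proof.
move=> hP.
have -> : (fun s => \sum_(i < d | P i) h i s) = \sum_(i < d | P i) h i.
  by apply/funext => s; rewrite fct_sumE.
by elim/big_ind2 : _ => // *; [exact: is_derive_cst|exact: is_deriveD].
Qed.

(** The Hessian at [x] of the potential whose gradient is the drift, applied to
    [v]; equivalently, the derivative of the drift at [x] in the direction [v]. *)
Definition drift_deriv {R : realType} (n : nat) {d : nat}
    (x v : 'I_d -> R) (k : 'I_d) : R :=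
  - (\sum_(j < d | j != k) ((v k - v j) / (x k - x j) ^+ 2 +
                            (v k + v j) / (x k + x j) ^+ 2) +
     (n%:R + 1) / x k ^+ 2 * v k).

Lemma chamber_sub_neq0 (R : realType) (d : nat) (x : 'I_d -> R) (j k : 'I_d) :
  chamber x -> j != k -> x k - x j != 0.
Proof.
move=> [xlt _]; rewrite -val_eqE /= subr_eq0 neq_ltn => /orP[jk|kj].
  by rewrite lt_eqF // xlt.
by rewrite gt_eqF // xlt.
Qed.

Lemma is_derive_drift {R : realType} (n : nat) {d : nat} (r : R -> 'I_d -> R)
    (v : 'I_d -> R) (t : R) (k : 'I_d) :
  chamber (r t) -> (forall j, is_derive t 1 (fun s => r s j) (v j)) ->
  is_derive t 1 (fun s => drift n (r s) k) (drift_deriv n (r t) v k).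
Proof.
move=> rt dr; have rpos := rt.2.
have dsum : is_derive t 1
    (fun s => \sum_(j < d | j != k) ((r s k - r s j)^-1 + (r s k + r s j)^-1))
    (\sum_(j < d | j != k) (- (r t k - r t j) ^- 2 *: (v k - v j) +
                            - (r t k + r t j) ^- 2 *: (v k + v j))).
  apply: is_derive1_sum => j jk; apply: is_deriveD; apply: is_deriveV.
  - exact: chamber_sub_neq0.
  - by rewrite gt_eqF // addr_gt0.
have dinv : is_derive t 1 (fun s => (n%:R + 1) / r s k)
    ((n%:R + 1) *: (- (r t k) ^- 2 *: v k)).
  by apply: is_deriveZ; apply: is_deriveV; rewrite ?gt_eqF.
have dsd := is_deriveD dsum dinv.
apply: (is_derive_eq dsd).
rewrite /drift_deriv opprD -sumrN; congr (_ + _).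
  apply: eq_bigr => j _.
  by rewrite /GRing.scale /= opprD !mulNr 2![_^-1 * _]mulrC.
by rewrite /GRing.scale /= !mulNr mulrN mulrA.
Qed.

(** The two summands of a pair [i < j] add up to minus a sum of squares:
    exchanging [i] and [j] leaves [(x i - x j) ^+ 2] unchanged but turns
    [v i - v j] into its opposite, so that the factors [v i] and [v j] join into
    a second copy of [v i - v j]; with [+] in place of [-] nothing changes sign
    and they join into a second copy of [v i + v j]. *)
Lemma drift_deriv_quadratic_form (R : realType) (n d : nat) (x v : 'I_d -> R) :
  \sum_(k < d) v k * drift_deriv n x v k =
  - (\sum_(k < d) (n%:R + 1) / x k ^+ 2 * v k ^+ 2 +
     \sum_(i < d) \sum_(j < d | (i < j)%N)
       ((v i - v j) ^+ 2 / (x i - x j) ^+ 2 +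
        (v i + v j) ^+ 2 / (x i + x j) ^+ 2)).
Proof.
pose F k j := v k * ((v k - v j) / (x k - x j) ^+ 2 +
                     (v k + v j) / (x k + x j) ^+ 2).
transitivity (- (\sum_(k < d) (n%:R + 1) / x k ^+ 2 * v k ^+ 2 +
                 \sum_(k < d) \sum_(j < d | j != k) F k j)).
  rewrite -big_split -sumrN; apply: eq_bigr => k _ /=.
  rewrite /drift_deriv /F -mulr_sumr; ring.
rewrite sum_offdiag_pairs; congr (- (_ + _)).
apply: eq_bigr => i _; apply: eq_bigr => j _.
rewrite /F -(opprB (x i) (x j)) sqrrN [x j + x i]addrC; ring.
Qed.

Theorem proposition3p3 (R : realType) (n d : nat) (hd : (1 <= d)%N)
    (hn : (d <= n)%N) (J : set R) (hJ : open J) (r : R -> 'I_d -> R)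
    (hr : forall t : R, J t -> chamber (r t)) (hode : solves_on n J r)
    (t : R) (ht : J t) :
  let E : R :=
    - 2 * (\sum_(k < d) (n%:R + 1) / r t k ^+ 2 * dot r k t ^+ 2 +
           \sum_(i < d) \sum_(j < d | (i < j)%N)
             ((dot r i t - dot r j t) ^+ 2 / (r t i - r t j) ^+ 2 +
              (dot r i t + dot r j t) ^+ 2 / (r t i + r t j) ^+ 2)) in
  [/\ derivable (fun s : R => fisher_info n (r s)) t 1,
      ((fun s : R => fisher_info n (r s))^`()%classic) t = E
    & E <= 0].
Proof.
move=> E; pose v := dot r ^~ t.
have dr j : is_derive t 1 (fun s => r s j) (v j).
  by have [dj _] := hode t ht j; rewrite /v /dot derive1E; exact: derivableP.
have dI : is_derive t 1 (fun s => fisher_info n (r s)) E.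
  have dD2 k : is_derive t 1 (fun s => drift n (r s) k ^+ 2)
      (2 * drift n (r t) k * drift_deriv n (r t) v k).
    by have := is_deriveX 2 (is_derive_drift n _ _ _ k (hr t ht) dr);
      rewrite expr1.
  apply: (is_derive_eq (is_derive1_sum _ _ xpredT _ _ t (fun k _ => dD2 k))).
  rewrite /E mulNr -mulrN -(drift_deriv_quadratic_form _ n _ (r t) v) mulr_sumr.
  by apply: eq_bigr => k _; have [_ <-] := hode t ht k; rewrite -mulrA.
split; [by case: dI|by rewrite derive1E derive_val|].
rewrite /E mulNr oppr_le0 mulr_ge0 // addr_ge0 // sumr_ge0 // => k _.
  by rewrite mulr_ge0 ?divr_ge0 ?sqr_ge0 ?addr_ge0.
by apply: sumr_ge0 => j _; rewrite addr_ge0 // divr_ge0 // sqr_ge0.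
Qed.
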